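(* Let $H$ be a separable complex Hilbert space, $J$ a conjugation in $H$, and let $A$ be a bounded J-unitary operator in $H$. Then $A$ admits a representation $$A=R\,e^{iK},$$ where $R$ is a J-real unitary operator in $H$ and $K$ is a bounded J-real skew-self-adjoint operator in $H$ (i.e. $K^*=-K$).
   Context: A conjugation in a Hilbert space $H$ is a map $J:H\to H$ with $J^2=E$ (the identity) and $(Jx,Jy)=\overline{(x,y)}$ for all $x,y\in H$ (hence $J$ is antilinear). Bounded operators are defined on all of $H$. A bounded operator $A$ is J-unitary if it is invertible and $A^{-1}=JA^*J$. A bounded operator $B$ is J-real if it commutes with $J$, i.e. $JBJ=B$. *)

(* Defs.v *)
From HB Require Import structures.
From mathcomp Require Import all_boot all_order all_algebra.
From mathcomp Require Import complex.
From mathcomp Require Import all_classical all_reals all_analysis.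

Set Implicit Arguments.
Unset Strict Implicit.
Unset Printing Implicit Defensive.

Import Order.TTheory GRing.Theory Num.Theory.
Import numFieldNormedType.Exports.

Local Open Scope classical_set_scope.
Local Open Scope ring_scope.

(* The form is linear in its first argument and conjugate-linear in the second
   one.  Norms and bounds live in [R[i]], whose order relates two numbers only
   when their difference is real. *)
HB.mixin Record CompleteNormedModule_isHilbert (R : realType) (H : Type)
    of CompleteNormedModule R[i] H := {
  dotp : {dot H for @Num.conj R[i]} ;
  dotp_norm : forall x : H, dotp x x = `|x| ^+ 2
}.

#[short(type="hilbertType")]
HB.structure Definition Hilbert (R : realType) :=
  {H of CompleteNormedModule_isHilbert R H & CompleteNormedModule R[i] H}.

Notation "''[' x , y ]" := (dotp x%R y%R) : ring_scope.

Definition separable_space (T : topologicalType) : Prop :=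
  exists2 D : set T, countable D & dense D.

Section Operators.
Context {R : realType} {H : hilbertType R}.
Implicit Types A B E J : H -> H.

Definition bounded_operator A : Prop :=
  linear A /\ exists M : R[i], forall x, `|A x| <= M * `|x|.

(* For bounded A the Riesz theorem gives exactly one such B, so that the default
   value 0 only matters for unbounded A. *)
Definition adjoint A : H -> H :=
  xget 0 [set B : H -> H | forall x y, '[A x, y] = '[x, B y]].

Definition unitary A : Prop :=
  [/\ bounded_operator A, cancel A (adjoint A) & cancel (adjoint A) A].

Definition skew_self_adjoint A : Prop := adjoint A = - A.

Definition conjugation J : Prop :=
  J \o J = id /\ forall x y, '[J x, J y] = ('[x, y])^*.

Definition J_unitary J A : Prop :=
  bounded_operator A /\
  exists A' : H -> H,
    [/\ bounded_operator A', cancel A A', cancel A' A & A' = J \o adjoint A \o J].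

Definition J_real J A : Prop := J \o A \o J = A.

(* convergence in operator norm *)
Definition operator_cvg (F : nat -> H -> H) E : Prop :=
  forall e : R[i], 0 < e ->
    \forall n \near \oo, forall x, `|F n x - E x| <= e * `|x|.

(* For bounded A the series converges in operator norm and its sum is unique;
   the default value 0 only matters for unbounded A. *)
Definition operator_exp A : H -> H :=
  xget 0 [set E : H -> H |
    operator_cvg (series (fun k => (k`!%:R)^-1 *: iter k A)) E].

End Operators.

(* Main.v *)
Require Import Defs.
From HB Require Import structures.
From mathcomp Require Import all_boot all_order all_algebra.
From mathcomp Require Import complex.
From mathcomp Require Import all_classical all_reals all_analysis.
From mathcomp Require Import ring lra.

Set Implicit Arguments.
Unset Strict Implicit.
Unset Printing Implicit Defensive.

Import Order.TTheory GRing.Theory Num.Theory.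
Import numFieldNormedType.Exports.

Local Open Scope classical_set_scope.
Local Open Scope ring_scope.

(** The Gram operator P = A^* A is positive and invertible, and J-unitarity of
    A says exactly that A J A^* = J = A^* J A, hence J P J = P^-1.  If S is a
    bounded self-adjoint logarithm of P^(1/2), that is exp(S)^2 = P, then
    U = A exp(-S) is unitary, since U^* U = exp(-S) P exp(-S) = 1 and U is
    invertible.  If moreover J S J = -S, then U is J-real, and K = -i S is
    bounded, skew-self-adjoint and J-real because J is antilinear; by
    construction A = U exp(iK).

    So everything rests on a logarithm that visibly changes sign under
    conjugation by J.  It is obtained from the Cayley transform
    W = (P - 1)(P + 1)^-1 of P.  This W is self-adjoint, it satisfies
    J W J = -W because J P J = P^-1, and its norm is less than 1 because P is
    bounded below ([cayley_transform_lt1]); the inverse of 1 + P is a Neumann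
    series ([one_plus_gram_invertible]).  Therefore the power series of
    log((1 + w)/(1 - w)) = 2 artanh(w) converges at W.  It is odd with real
    coefficients, so its value L at W is self-adjoint and J L J = -L, and one
    takes S = L/2 ([gram_logarithm]).

    The remaining point is exp(L) (1 - W) = 1 + W ([bexp_cayley_log]), which
    gives exp(L) = P since 1 + W and 1 - W are 2 P (1 + P)^-1 and 2 (1 + P)^-1.
    Truncated exponentials of the partial sums of the series are polynomials
    in W.  A differential equation for formal series, read as a recurrence on
    coefficients, shows that their coefficients never exceed those of
    (1 + w)/(1 - w) = 1 + 2w + 2w^2 + ..., and agree with them up to the order
    of truncation ([coef_exp_cayley_log]); since |W| < 1 the discrepancy tends
    to 0 in norm.

    All estimates take place in the algebra of bounded operators, considered
    as a Banach algebra over the real numbers. *)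

(** * Norms of vectors as real numbers *)

Section RealNorm.
Context {R : realType} {H : normedModType R[i]}.
Implicit Types x y : H.

Definition rnorm x : R := complex.Re `|x|.

Lemma rnormE x : `|x| = (rnorm x)%:C%C.
Proof. by rewrite /rnorm RRe_real// normr_real. Qed.

Lemma rnorm_ge0 x : 0 <= rnorm x.
Proof. by rewrite -lecR -rnormE normr_ge0. Qed.

Lemma rnormD x y : rnorm (x + y) <= rnorm x + rnorm y.
Proof. by rewrite -lecR rmorphD/= -!rnormE ler_normD. Qed.

Lemma rnormN x : rnorm (- x) = rnorm x.
Proof. by rewrite /rnorm normrN. Qed.

Lemma rnormB x y : rnorm (x - y) <= rnorm x + rnorm y.
Proof. by rewrite -[leRHS](congr1 _ (rnormN y)) rnormD. Qed.

Lemma rnorm0 : rnorm (0 : H) = 0.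
Proof. by rewrite /rnorm normr0. Qed.

Lemma rnorm_eq0 x : (rnorm x == 0) = (x == 0).
Proof. by rewrite -(inj_eq (@complexI R)) -rnormE normr_eq0. Qed.

Lemma rnormZ (c : R[i]) x : rnorm (c *: x) = complex.Re `|c| * rnorm x.
Proof.
apply: (@complexI R).
by rewrite rmorphM/= -(rnormE (c *: x)) -(rnormE x) normrZ.
Qed.

Lemma rnormZR (c : R) x : rnorm (c%:C%C *: x) = `|c| * rnorm x.
Proof. by rewrite rnormZ normc_def/= expr0n addr0 sqrtr_sqr. Qed.

End RealNorm.
(** * The real Banach algebra of bounded operators *)

Section BoundedOperators.
Context {R : realType} {H : completeNormedModType R[i]}.

(** The proof [nz] that the space is not zero makes the identity differ from 0,
    as a ring in which polynomials are evaluated requires. *)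
Record bop (nz : exists x : H, x != 0) := Bop {
  bop_fun :> H -> H;
  bop_linear : linear bop_fun;
  bop_bounded : exists M : R, forall x, rnorm (bop_fun x) <= M * rnorm x
}.

Context {nz : exists x : H, x != 0}.
Local Notation B := (bop nz).
Implicit Types X Y Z : B.

Lemma bopP X Y : X =1 Y -> X = Y.
Proof.
case: X Y => [f fl fb] [g gl gb] /= /funext fg.
by rewrite {f}fg in fl fb *; congr Bop; exact: Prop_irrelevance.
Qed.

Lemma bopD X x y : X (x + y) = X x + X y.
Proof. by have := bop_linear X 1 x y; rewrite !scale1r. Qed.

Lemma bop0 X : X 0 = 0.
Proof. by apply: (addrI (X 0)); rewrite -bopD !addr0. Qed.

Lemma bopZ X c x : X (c *: x) = c *: X x.
Proof. by have := bop_linear X c x 0; rewrite bop0 !addr0. Qed.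

HB.instance Definition _ := gen_eqMixin B.
HB.instance Definition _ := gen_choiceMixin B.

Fact bop0_linear : linear (fun _ : H => 0 : H).
Proof. by move=> c x y; rewrite scaler0 addr0. Qed.
Fact bop0_bounded : exists M : R, forall x : H, rnorm (0 : H) <= M * rnorm x.
Proof. by exists 0 => x; rewrite rnorm0 mul0r. Qed.
Definition bop_zero : B := Bop nz bop0_linear bop0_bounded.

Fact bop1_linear : linear (@idfun H).
Proof. by []. Qed.
Fact bop1_bounded : exists M : R, forall x : H, rnorm (idfun x) <= M * rnorm x.
Proof. by exists 1 => x; rewrite mul1r. Qed.
Definition bop_one : B := Bop nz bop1_linear bop1_bounded.

Fact bopD_linear X Y : linear (fun x => X x + Y x).
Proof. by move=> c x y; rewrite !bop_linear scalerDr addrACA. Qed.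
Fact bopD_bounded X Y :
  exists M : R, forall x, rnorm (X x + Y x) <= M * rnorm x.
Proof.
have [M XM] := bop_bounded X; have [N YN] := bop_bounded Y.
by exists (M + N) => x; rewrite (le_trans (rnormD _ _))// mulrDl lerD.
Qed.
Definition bop_add X Y : B := Bop nz (bopD_linear X Y) (bopD_bounded X Y).

Fact bopN_linear X : linear (fun x => - X x).
Proof. by move=> c x y; rewrite bop_linear opprD scalerN. Qed.
Fact bopN_bounded X : exists M : R, forall x, rnorm (- X x) <= M * rnorm x.
Proof.
by have [M XM] := bop_bounded X; exists M => x; rewrite rnormN.
Qed.
Definition bop_opp X : B := Bop nz (bopN_linear X) (bopN_bounded X).

Fact bopM_linear X Y : linear (X \o Y).
Proof. by move=> c x y /=; rewrite !bop_linear. Qed.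
Fact bopM_bounded X Y :
  exists M : R, forall x, rnorm ((X \o Y) x) <= M * rnorm x.
Proof.
have [M XM] := bop_bounded X; have [N YN] := bop_bounded Y.
exists (`|M| * N) => x; rewrite (le_trans (XM _))//.
rewrite (le_trans (ler_wpM2r (rnorm_ge0 _) (ler_norm M)))//.
by rewrite -mulrA ler_wpM2l.
Qed.
Definition bop_mul X Y : B := Bop nz (bopM_linear X Y) (bopM_bounded X Y).

Fact bopZ_linear (r : R) X : linear (fun x => r%:C%C *: X x).
Proof.
by move=> c x y; rewrite bop_linear scalerDr !scalerA mulrC.
Qed.
Fact bopZ_bounded (r : R) X :
  exists M : R, forall x, rnorm (r%:C%C *: X x) <= M * rnorm x.
Proof.
have [M XM] := bop_bounded X.
by exists (`|r| * M) => x; rewrite rnormZR -mulrA ler_wpM2l.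
Qed.
Definition bop_scale (r : R) X : B :=
  Bop nz (bopZ_linear r X) (bopZ_bounded r X).

Fact bop_addA : associative bop_add.
Proof. by move=> X Y Z; apply: bopP => x /=; rewrite addrA. Qed.
Fact bop_addC : commutative bop_add.
Proof. by move=> X Y; apply: bopP => x /=; rewrite addrC. Qed.
Fact bop_add0 : left_id bop_zero bop_add.
Proof. by move=> X; apply: bopP => x /=; rewrite add0r. Qed.
Fact bop_addN : left_inverse bop_zero bop_opp bop_add.
Proof. by move=> X; apply: bopP => x /=; rewrite addNr. Qed.
HB.instance Definition _ :=
  GRing.isZmodule.Build B bop_addA bop_addC bop_add0 bop_addN.

Fact bop_mulA : associative bop_mul.
Proof. by move=> X Y Z; apply: bopP. Qed.
Fact bop_mul1 : left_id bop_one bop_mul.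
Proof. by move=> X; apply: bopP. Qed.
Fact bop_mulr1 : right_id bop_one bop_mul.
Proof. by move=> X; apply: bopP. Qed.
Fact bop_mulDl : left_distributive bop_mul +%R.
Proof. by move=> X Y Z; apply: bopP. Qed.
Fact bop_mulDr : right_distributive bop_mul +%R.
Proof. by move=> X Y Z; apply: bopP => x /=; rewrite bopD. Qed.
Fact bop_1neq0 : bop_one != 0.
Proof.
by case: nz => x /eqP x0; apply/eqP => /(congr1 (fun Z : B => Z x)).
Qed.
HB.instance Definition _ := GRing.Zmodule_isNzRing.Build B
  bop_mulA bop_mul1 bop_mulr1 bop_mulDl bop_mulDr bop_1neq0.

Fact bop_scaleA (a b : R) X : bop_scale a (bop_scale b X) = bop_scale (a * b) X.
Proof. by apply: bopP => x /=; rewrite scalerA rmorphM. Qed.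
Fact bop_scale1 : left_id 1 bop_scale.
Proof. by move=> X; apply: bopP => x /=; rewrite rmorph1 scale1r. Qed.
Fact bop_scaleDr : right_distributive bop_scale +%R.
Proof. by move=> a X Y; apply: bopP => x /=; rewrite scalerDr. Qed.
Fact bop_scaleDl X : {morph bop_scale^~ X : a b / a + b}.
Proof. by move=> a b; apply: bopP => x /=; rewrite rmorphD scalerDl. Qed.
HB.instance Definition _ := GRing.Zmodule_isLmodule.Build R B
  bop_scaleA bop_scale1 bop_scaleDr bop_scaleDl.

Fact bop_scaleAl (a : R) X Y : a *: (X * Y) = a *: X * Y.
Proof. exact: bopP. Qed.
HB.instance Definition _ := GRing.Lmodule_isLalgebra.Build R B bop_scaleAl.
Fact bop_scaleAr (a : R) X Y : a *: (X * Y) = X * (a *: Y).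
Proof. by apply: bopP => x /=; rewrite bopZ. Qed.
HB.instance Definition _ := GRing.Lalgebra_isAlgebra.Build R B bop_scaleAr.

Lemma bopE0 x : (0 : B) x = 0. Proof. by []. Qed.
Lemma bopE1 x : (1 : B) x = x. Proof. by []. Qed.
Lemma bopED X Y x : (X + Y) x = X x + Y x. Proof. by []. Qed.
Lemma bopEN X x : (- X) x = - X x. Proof. by []. Qed.
Lemma bopEB X Y x : (X - Y) x = X x - Y x. Proof. by []. Qed.
Lemma bopEM X Y x : (X * Y) x = X (Y x). Proof. by []. Qed.
Lemma bopEZ (r : R) X x : (r *: X) x = r%:C%C *: X x. Proof. by []. Qed.
Definition bopE := (bopE0, bopE1, bopED, bopEN, bopEB, bopEM, bopEZ).

Lemma bopEX X n x : (X ^+ n) x = iter n X x.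
Proof. by elim: n => //= n <-; rewrite exprS. Qed.

Lemma bop_sumE (u : nat -> B) n x :
  (\sum_(0 <= k < n) u k) x = \sum_(0 <= k < n) u k x.
Proof.
elim: n => [|n IHn]; first by rewrite !big_geq.
by rewrite !big_nat_recr//= -IHn.
Qed.

Definition opnorm X : R :=
  inf [set M | 0 <= M /\ forall x, rnorm (X x) <= M * rnorm x].

Lemma opnorm_le X M : 0 <= M -> (forall x, rnorm (X x) <= M * rnorm x) ->
  opnorm X <= M.
Proof.
by move=> M0 XM; apply: ge_inf; [exists 0 => ? -[] | split].
Qed.

Lemma opnormP X x : rnorm (X x) <= opnorm X * rnorm x.
Proof.
have [->|x0] := eqVneq x 0; first by rewrite bop0 rnorm0 mulr0.
have x_gt0 : 0 < rnorm x by rewrite lt_def rnorm_ge0 rnorm_eq0 x0.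
rewrite -ler_pdivrMr//; apply: lb_le_inf => [|M [_ XM]]; last first.
  by rewrite ler_pdivrMr.
have [M XM] := bop_bounded X; exists `|M|; split=> // y.
by rewrite (le_trans (XM y))// ler_wpM2r ?rnorm_ge0// ler_norm.
Qed.

Lemma opnorm_ge0 X : 0 <= opnorm X.
Proof.
case: nz => x x0; have : 0 <= opnorm X * rnorm x.
  exact: le_trans (rnorm_ge0 _) (opnormP X x).
by rewrite pmulr_lge0// lt_def rnorm_ge0 rnorm_eq0 x0.
Qed.

Fact opnormD X Y : opnorm (X + Y) <= opnorm X + opnorm Y.
Proof.
apply: opnorm_le => [|x]; first by rewrite addr_ge0 ?opnorm_ge0.
by rewrite (le_trans (rnormD _ _))// mulrDl lerD ?opnormP.
Qed.

Fact opnormZ (r : R) X : opnorm (r *: X) = `|r| * opnorm X.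
Proof.
have le_opnormZ (s : R) Y : opnorm (s *: Y) <= `|s| * opnorm Y.
  apply: opnorm_le => [|x]; first by rewrite mulr_ge0 ?opnorm_ge0.
  by rewrite rnormZR -mulrA ler_wpM2l ?opnormP.
apply/le_anti; rewrite le_opnormZ/=.
have [->|r0] := eqVneq r 0; first by rewrite normr0 mul0r opnorm_ge0.
rewrite -ler_pdivlMl ?normr_gt0// -normfV.
by rewrite -[X in opnorm X <= _](scalerK r0) le_opnormZ.
Qed.

Fact opnorm_eq0 X : opnorm X = 0 -> X = 0.
Proof.
move=> X0; apply: bopP => x; apply/eqP.
rewrite -rnorm_eq0 eq_le rnorm_ge0 andbT.
by rewrite (le_trans (opnormP X x))// X0 mul0r.
Qed.

HB.instance Definition _ :=
  Lmodule_isNormed.Build R B opnormD opnormZ opnorm_eq0.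

Lemma le_bop_norm X x : rnorm (X x) <= `|X| * rnorm x.
Proof. exact: opnormP. Qed.

Lemma bop_norm_le X M : 0 <= M -> (forall x, rnorm (X x) <= M * rnorm x) ->
  `|X| <= M.
Proof. exact: opnorm_le. Qed.

Lemma bop_normM X Y : `|X * Y| <= `|X| * `|Y|.
Proof.
apply: bop_norm_le => [|x]; first by rewrite mulr_ge0.
by rewrite (le_trans (le_bop_norm X _))// -mulrA ler_wpM2l// le_bop_norm.
Qed.

Lemma bop_norm1_le : `|1 : B| <= 1.
Proof. by apply: bop_norm_le => // x; rewrite mul1r. Qed.

Lemma bop_normX X n : `|X ^+ n| <= `|X| ^+ n.
Proof.
elim: n => [|n IHn]; first exact: bop_norm1_le.
rewrite exprS [leRHS]exprS (le_trans (bop_normM _ _))//. exact: ler_wpM2l.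
Qed.

End BoundedOperators.
Section BopComplete.
Context {R : realType} {H : completeNormedModType R[i]}.
Context {nz : exists x : H, x != 0}.
Local Notation B := (bop nz).

(** A Cauchy filter converges pointwise because the space is complete.  The
    pointwise limit inherits linearity, and any operator one of whose balls
    belongs to the filter bounds the distance to the limit uniformly. *)
Lemma bop_complete (F : set_system B) : ProperFilter F -> cauchy F -> cvg F.
Proof.
move=> FF /cauchyP Fc.
have Fx x : cvg ((fun X : B => X x) @ F).
  apply: cauchy_cvg; apply/cauchyP => e e0.
  have re0 : 0 < complex.Re e by rewrite -ltcR RRe_real ?gtr0_real.
  have k0 : 0 < complex.Re e / (rnorm x + 1).
    by rewrite divr_gt0// ltr_wpDl// rnorm_ge0.
  have [X FX] := Fc _ k0; exists (X x).
  suff: F [set Y : B | ball (X x) e (Y x)] by [].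
  apply: filterS FX => Y /=.
  rewrite -!ball_normE/= => XY.
  rewrite rnormE -[e]RRe_real ?gtr0_real// ltcR -bopEB.
  rewrite (le_lt_trans (le_bop_norm _ _))//.
  rewrite (@le_lt_trans _ _ (complex.Re e / (rnorm x + 1) * rnorm x))//.
    by rewrite ler_wpM2r ?rnorm_ge0// ltW.
  rewrite -mulrA gtr_pMr// mulrC ltr_pdivrMr ?mul1r ?ltrDl//.
  by rewrite ltr_wpDl ?rnorm_ge0.
pose L x := lim ((fun X : B => X x) @ F).
have FL x : (fun X : B => X x) @ F --> L x by exact: Fx.
(* an operator whose ball is a member of the filter is close to the limit *)
have XL (e : R) X : 0 < e -> F (ball X e) ->
    forall x, rnorm (X x - L x) <= e * rnorm x.
  move=> e0 FX x; apply/ler_addgt0Pr => d d0.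
  have dC : 0 < d%:C%C :> R[i] by rewrite ltcR.
  have /cvgrPdist_lt/(_ _ dC) FLx := FL x.
  have [Y [/= LY]] := filter_ex (filterI FLx FX).
  rewrite -ball_normE/= => XY.
  have -> : X x - L x = (X - Y) x - (L x - Y x).
    by rewrite bopEB opprB addrA subrK.
  rewrite (le_trans (rnormB _ _))// lerD//; last first.
    by rewrite ltW// -ltcR -rnormE.
  rewrite (le_trans (le_bop_norm _ _))// ler_wpM2r ?rnorm_ge0//.
  exact: ltW.
have Llin : linear L.
  move=> c x y; apply: cvg_lim => //.
  have -> : (fun X : B => X (c *: x + y)) = (fun X => c *: X x + X y).
    by apply: funext => X; rewrite bop_linear.
  by apply: cvgD; [apply: cvgZr; exact: FL | exact: FL].
have Lbd : exists M : R, forall x, rnorm (L x) <= M * rnorm x.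
  have [X FX] := Fc _ ltr01; exists (`|X| + 1) => x.
  rewrite -[L x](subKr (X x)) (le_trans (rnormB _ _))// mulrDl lerD//.
    exact: le_bop_norm.
  exact: XL.
apply/cvg_ex; exists (Bop nz Llin Lbd); apply/cvgrPdist_lt => e e0.
have e2 : 0 < e / 3 by rewrite divr_gt0.
have [X FX] := Fc _ e2; near=> Y.
have XY : ball X (e / 3) Y by near: Y.
rewrite -(subrKA X) (le_lt_trans (ler_normD _ _))//.
apply: (@le_lt_trans _ _ (e / 3 + e / 3)); last by lra.
rewrite lerD//; last by move: XY; rewrite -ball_normE => /ltW.
rewrite distrC bop_norm_le// ?ltW// => x.
exact: XL.
Unshelve. all: by end_near.
Qed.

HB.instance Definition _ := Uniform_isComplete.Build B bop_complete.

End BopComplete.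
(** * Truncated exponentials in an algebra *)

Lemma sum_triangle (V : nmodType) (F : nat -> nat -> V) N :
  \sum_(0 <= k < N) \sum_(0 <= i < k.+1) F (k - i)%N i =
  \sum_(0 <= i < N) \sum_(0 <= j < N - i) F j i.
Proof.
elim: N => [|N IHN]; first by rewrite !big_geq.
rewrite big_nat_recr//= IHN [X in _ + X]big_nat_recr//= [RHS]big_nat_recr//=.
rewrite subnn subSnn big_nat1 addrA.
congr (_ + _); rewrite -big_split/=; apply: eq_big_nat => i /andP[_ iN].
by rewrite subSn ?(ltnW iN)// big_nat_recr.
Qed.

Section ExpTrunc.
Context {R : realType} {A : algType R}.
Implicit Types x y : A.

(** The algebra is arbitrary because these sums are compared in three of them:
    bounded operators, real numbers and real polynomials. *)
Definition exp_trunc N x : A := \sum_(0 <= k < N) (k`!%:R)^-1 *: x ^+ k.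

Lemma exp_truncS N x :
  exp_trunc N.+1 x = exp_trunc N x + (N`!%:R)^-1 *: x ^+ N.
Proof. by rewrite /exp_trunc big_nat_recr. Qed.

Lemma exp_term_add x y n : GRing.comm x y ->
  (n`!%:R)^-1 *: (x + y) ^+ n =
  \sum_(0 <= i < n.+1)
    ((n - i)`!%:R)^-1 *: x ^+ (n - i) * ((i`!%:R)^-1 *: y ^+ i).
Proof.
move=> cxy; rewrite exprDn_comm// scaler_sumr big_mkord; apply: eq_bigr => i _.
rewrite -[_ *+ 'C(n, i)]scaler_nat [LHS]scalerA.
rewrite -scalerAl -scalerAr [RHS]scalerA.
congr (_ *: _).
have ile : (i <= n)%N by rewrite -ltnS.
rewrite -[in LHS](bin_fact ile) !natrM.
by field; rewrite !pnatr_eq0 -!lt0n !fact_gt0 bin_gt0.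
Qed.

(** The product of the two truncations runs over the terms x^j y^i / (j! i!) of
    the square i, j < N, and by the binomial formula the truncation at x + y
    runs over those of the triangle i + j < N.  What matters below is that the
    difference has nonnegative coefficients. *)
Lemma exp_trunc_mulB N x y : GRing.comm x y ->
  exp_trunc N x * exp_trunc N y - exp_trunc N (x + y) =
  \sum_(0 <= i < N) \sum_(N - i <= j < N)
    (j`!%:R)^-1 *: x ^+ j * ((i`!%:R)^-1 *: y ^+ i).
Proof.
move=> cxy; pose F j i := (j`!%:R)^-1 *: x ^+ j * ((i`!%:R)^-1 *: y ^+ i).
have -> : exp_trunc N x * exp_trunc N y =
    \sum_(0 <= i < N) \sum_(0 <= j < N) F j i.
  rewrite mulr_sumr; apply: eq_bigr => i _; exact: mulr_suml.
have -> : exp_trunc N (x + y) =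
    \sum_(0 <= i < N) \sum_(0 <= j < N - i) F j i.
  under [LHS]eq_bigr do rewrite exp_term_add//.
  exact: (sum_triangle F).
rewrite -sumrB; apply: eq_big_nat => i /andP[_ iN].
rewrite [X in X - _](big_cat_nat (n := N - i)) ?leq_subr//=.
by rewrite addrAC subrr add0r.
Qed.
End ExpTrunc.
(** * Power series of operators and the exponential *)

Section BopSeries.
Context {R : realType} {H : completeNormedModType R[i]}.
Context {nz : exists x : H, x != 0}.
Local Notation B := (bop nz).
Implicit Types X Y : B.

Lemma bop_cvg_unique (F : nat -> B) X Y :
  F @ \oo --> X -> F @ \oo --> Y -> X = Y.
Proof. by move=> FX FY; apply: (cvg_unique _ FX FY); exact: norm_hausdorff. Qed.

Lemma bop_cvg_norm (F : nat -> B) X (u : nat -> R) :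
  (forall n, `|F n - X| <= u n) -> u @ \oo --> 0 -> F @ \oo --> X.
Proof.
move=> Fu u0; apply/subr_cvg0/norm_cvg0P.
apply: (@squeeze_cvgr _ _ _ _ (cst 0) u) => //; last exact: cvg_cst.
by apply: nearW => n; rewrite normr_ge0 Fu.
Qed.

Lemma bop_cvg_transfer (F G : nat -> B) X :
  (fun n => F n - G n) @ \oo --> 0 -> G @ \oo --> X -> F @ \oo --> X.
Proof.
move=> FG GX; rewrite -(add0r X).
have -> : F = (fun n => F n - G n) + G.
  by apply: funext => n; exact/esym/subrK.
exact: cvgD.
Qed.

Lemma bop_cvgM (F G : nat -> B) X Y :
  F @ \oo --> X -> G @ \oo --> Y -> (fun n => F n * G n) @ \oo --> X * Y.
Proof.
move=> FX GY.
apply: (@bop_cvg_norm _ _ (fun n => `|F n - X| * `|G n| + `|X| * `|G n - Y|)).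
  move=> n; have -> : F n * G n - X * Y = (F n - X) * G n + X * (G n - Y).
    by rewrite mulrBl mulrBr addrA subrK.
  by rewrite (le_trans (ler_normD _ _))// lerD// bop_normM.
have FX0 : `|F n - X| @[n --> \oo] --> (0 : R).
  by apply/norm_cvg0P; apply/subr_cvg0.
have GY0 : `|G n - Y| @[n --> \oo] --> (0 : R).
  by apply/norm_cvg0P; apply/subr_cvg0.
rewrite -[0 in X in _ --> X](addr0 0); apply: cvgD.
  by rewrite -(mul0r `|Y|); apply: cvgM => //; exact: cvg_norm.
by rewrite -(mulr0 `|X|); apply: cvgM => //; exact: cvg_cst.
Qed.

Definition power_series (c : nat -> R) X : B :=
  limn (series (fun k => c k *: X ^+ k)).

Lemma power_series_cvg (c : nat -> R) X :
  cvgn (series (fun k => `|c k| * `|X| ^+ k)) ->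
  series (fun k => c k *: X ^+ k) @ \oo --> power_series c X.
Proof.
move=> cX; apply: normed_cvg; apply: series_le_cvg cX => //= n.
by rewrite normrZ ler_wpM2l// bop_normX.
Qed.

Lemma bounded_power_series_cvg (M : R) (c : nat -> R) X :
  (forall k, `|c k| <= M) -> `|X| < 1 ->
  series (fun k => c k *: X ^+ k) @ \oo --> power_series c X.
Proof.
move=> cM X1; apply: power_series_cvg.
have M0 : 0 <= M := le_trans (normr_ge0 _) (cM 0%N).
apply: (@series_le_cvg _ _ (geometric M `|X|)) => [k|k|k|].
- by rewrite mulr_ge0// exprn_ge0.
- exact: geometric_ge0.
- by rewrite ler_wpM2r// exprn_ge0.
- by apply: is_cvg_geometric_series; rewrite normr_id.
Qed.

Lemma neumann_inverse X : `|X| < 1 ->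
  exists Y, Y * (1 - X) = 1 /\ (1 - X) * Y = 1.
Proof.
move=> X1; pose Y := power_series (fun=> 1) X; exists Y.
have YX : series (fun k => X ^+ k) @ \oo --> Y.
  have := @bounded_power_series_cvg 1 (fun=> 1) X.
  by under eq_fun do rewrite scale1r; apply => // _; rewrite normr1.
have X0 : (fun n => X ^+ n) @ \oo --> 0.
  apply: (@bop_cvg_norm _ _ (fun n => `|X| ^+ n)) => [n|].
    by rewrite subr0 bop_normX.
  by apply: cvg_expr; rewrite normr_id.
have SX n : series (fun k => X ^+ k) n * (1 - X) = 1 - X ^+ n.
  rewrite /series/= mulr_suml -[RHS]opprB -(expr0 X) -telescope_sumr//.
  by rewrite -sumrN; apply: eq_bigr => i _; rewrite mulrBr mulr1 -exprSr opprB.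
have XS n : (1 - X) * series (fun k => X ^+ k) n = 1 - X ^+ n.
  rewrite -SX; apply: commr_sum => i _; apply: commr_sym.
  by apply: commrB; [exact: commr1 | exact/commr_sym/commrX].
have lim1 : (fun n => 1 - X ^+ n) @ \oo --> (1 : B).
  by rewrite -[X in _ --> X]subr0; apply: cvgB X0; exact: cvg_cst.
split; apply: bop_cvg_unique lim1.
- under eq_fun do rewrite -SX.
  apply: bop_cvgM YX _; exact: cvg_cst.
- under eq_fun do rewrite -XS.
  apply: bop_cvgM YX; exact: cvg_cst.
Qed.

Definition bexp X : B := power_series (fun k => (k`!%:R)^-1) X.

Lemma exp_truncE (x : R) N : exp_trunc N (x : R^o) = series (exp_coeff x) N.
Proof. by apply: eq_bigr => k _; rewrite [RHS]mulrC. Qed.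

Lemma exp_trunc_cvgR (x : R) :
  exp_trunc n (x : R^o) @[n --> \oo] --> expR x.
Proof.
by under eq_fun do rewrite exp_truncE; exact: is_cvg_series_exp_coeff.
Qed.

Lemma bexp_cvg X : exp_trunc n X @[n --> \oo] --> bexp X.
Proof.
apply: power_series_cvg; set u := fun k => _.
have -> : u = exp_coeff `|X|.
  by apply: funext => k; rewrite /u/= [RHS]mulrC ger0_norm ?invr_ge0.
exact: is_cvg_series_exp_coeff.
Qed.

Arguments exp_trunc_cvgR : clear implicits.
Arguments bexp_cvg : clear implicits.

Lemma exp_trunc_le_expR (x : R) N : 0 <= x -> exp_trunc N (x : R^o) <= expR x.
Proof.
move=> x0; rewrite exp_truncE; apply: nondecreasing_cvgn_le.
  by apply: nondecreasing_series => n _ _; exact: exp_coeff_ge0.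
exact: is_cvg_series_exp_coeff.
Qed.

(** By [exp_trunc_mulB] the defect of multiplicativity of the truncations is a
    polynomial in X and Y with nonnegative coefficients.  Its norm is thus at
    most the same defect at the real numbers |X| and |Y|, and that one tends
    to 0 because the real exponential is multiplicative. *)
Lemma bexpD X Y : GRing.comm X Y -> bexp (X + Y) = bexp X * bexp Y.
Proof.
move=> cXY.
apply: bop_cvg_unique (bexp_cvg (X + Y)) _.
pose u n : R := exp_trunc n (`|X| : R^o) * exp_trunc n (`|Y| : R^o)
                - exp_trunc n (`|X| + `|Y| : R^o).
have u0 : u @ \oo --> 0.
  rewrite -(subrr (expR (`|X| + `|Y|))) [X in X - _]expRD.
  by apply: cvgB (exp_trunc_cvgR _); apply: cvgM; exact: exp_trunc_cvgR.
have D0 : (fun n => exp_trunc n (X + Y) - exp_trunc n X * exp_trunc n Y)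
    @ \oo --> 0.
  apply: bop_cvg_norm u0 => n; rewrite subr0 distrC exp_trunc_mulB//.
  rewrite /u exp_trunc_mulB; last exact: mulrC.
  rewrite (le_trans (ler_norm_sum _ _ _))// ler_sum// => i _.
  rewrite (le_trans (ler_norm_sum _ _ _))// ler_sum// => j _.
  rewrite (le_trans (bop_normM _ _))// ler_pM// normrZ ger0_norm ?invr_ge0//.
    by rewrite ler_wpM2l ?invr_ge0// bop_normX.
  by rewrite ler_wpM2l ?invr_ge0// bop_normX.
exact: bop_cvg_transfer D0 (bop_cvgM (bexp_cvg X) (bexp_cvg Y)).
Qed.

Lemma bexp0 : bexp 0 = 1.
Proof.
have e0 n : exp_trunc n.+1 (0 : B) = 1.
  elim: n => [|n IHn]; first by rewrite /exp_trunc big_nat1 fact0 invr1 scale1r.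
  by rewrite exp_truncS IHn expr0n scaler0 addr0.
apply: (@bop_cvg_unique (fun n => exp_trunc n.+1 (0 : B))).
- by rewrite (@cvg_shiftS B (fun n => exp_trunc n (0 : B))); exact: bexp_cvg.
- by under eq_fun do rewrite e0; exact: cvg_cst.
Qed.

Lemma bexpNK X : bexp (- X) * bexp X = 1.
Proof. by rewrite -bexpD ?addNr ?bexp0//; exact/commr_sym/commrN. Qed.

Lemma bexpKN X : bexp X * bexp (- X) = 1.
Proof. by rewrite -[X in bexp X * _]opprK bexpNK. Qed.

Lemma bop_exprB_le X Y (c : R) k : `|X| <= c -> `|Y| <= c ->
  `|X ^+ k.+1 - Y ^+ k.+1| <= k.+1%:R * c ^+ k * `|X - Y|.
Proof.
move=> Xc Yc; have c0 : 0 <= c := le_trans (normr_ge0 _) Xc.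
elim: k => [|k IHk]; first by rewrite !expr1 expr0 !mul1r.
rewrite exprS [in X in _ - X]exprS.
have -> : X * X ^+ k.+1 - Y * Y ^+ k.+1 =
    X * (X ^+ k.+1 - Y ^+ k.+1) + (X - Y) * Y ^+ k.+1.
  by rewrite mulrBr mulrBl addrA subrK.
rewrite (le_trans (ler_normD _ _))//.
have -> : k.+2%:R * c ^+ k.+1 * `|X - Y| =
    c * (k.+1%:R * c ^+ k * `|X - Y|) + `|X - Y| * c ^+ k.+1.
  by rewrite -[k.+2]addn1 natrD exprS; ring.
rewrite lerD// (le_trans (bop_normM _ _))//; first by rewrite ler_pM.
rewrite ler_wpM2l// (le_trans (bop_normX _ _))//.
by rewrite lerXn2r ?nnegrE.
Qed.

(** Uniformity in N is the point: it allows the exponent and the order of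
    truncation to vary together in [exp_trunc_cvg]. *)
Lemma exp_trunc_lipschitz X Y (c : R) N : `|X| <= c -> `|Y| <= c ->
  `|exp_trunc N X - exp_trunc N Y| <= expR c * `|X - Y|.
Proof.
move=> Xc Yc; have c0 : 0 <= c := le_trans (normr_ge0 _) Xc.
case: N => [|N].
  by rewrite /exp_trunc !big_geq// subrr normr0 mulr_ge0 ?expR_ge0.
rewrite /exp_trunc -sumrB big_nat_recl//= !expr0 subrr add0r.
rewrite (le_trans (ler_norm_sum _ _ _))//.
apply: (@le_trans _ _ (exp_trunc N (c : R^o) * `|X - Y|)); last first.
  by rewrite ler_wpM2r// exp_trunc_le_expR.
rewrite mulr_suml; apply: ler_sum => k _.
rewrite -scalerBr normrZ ger0_norm ?invr_ge0//.
rewrite (le_trans (ler_wpM2l _ (bop_exprB_le _ Xc Yc))) ?invr_ge0//.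
rewrite factS natrM invfM !mulrA ler_wpM2r//.
by rewrite [_^-1 * _^-1]mulrC mulfVK ?pnatr_eq0.
Qed.

Lemma exp_trunc_cvg (F : nat -> B) X : F @ \oo --> X ->
  exp_trunc n (F n) @[n --> \oo] --> bexp X.
Proof.
move=> FX.
have FX0 : `|F n - X| @[n --> \oo] --> (0 : R).
  by apply/norm_cvg0P; apply/subr_cvg0.
suff D0 : (fun n => exp_trunc n (F n) - exp_trunc n X) @ \oo --> 0.
  exact: bop_cvg_transfer D0 (bexp_cvg X).
apply/norm_cvg0P.
apply: (@squeeze_cvgr _ _ _ _ (cst 0)
  (fun n => expR (`|X| + 1) * `|F n - X|)); last 2 first.
- exact: cvg_cst.
- by rewrite -(mulr0 (expR (`|X| + 1))); apply: cvgM => //; exact: cvg_cst.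
near=> n; rewrite normr_ge0/= exp_trunc_lipschitz ?lerDl//.
rewrite -[F n](subrK X) addrC (le_trans (ler_normD _ _))// lerD2l.
near: n; have /cvgrPdist_le/(_ 1 ltr01) := FX.
by apply: filterS => n; rewrite distrC.
Unshelve. all: by end_near.
Qed.

End BopSeries.
(** * The logarithm of the Cayley transform *)

Section CayleyLogarithm.
Context {R : realType}.

(** Taylor coefficients of (1 + w)/(1 - w) at 0. *)
Definition cayley_coef n : R := if n is 0%N then 1 else 2.

(** Taylor coefficients of log((1 + w)/(1 - w)) = 2 (w + w^3/3 + w^5/5 + ...)
    at 0; the quotient by k = 0 is harmless since the numerator vanishes. *)
Definition cayley_log_coef k : R := (odd k)%:R * 2 / k%:R.

Definition cayley_log_trunc N : {poly R} := \poly_(k < N) cayley_log_coef k.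

(** Coefficientwise form of the equation G' = 2 G/(1 - w^2) satisfied by
    G = (1 + w)/(1 - w), whose derivative has coefficients 2 (n + 1). *)
Lemma cayley_coef_convolution n :
  \sum_(0 <= i < n.+1) cayley_coef i * (~~ odd (n - i))%:R = n.+1%:R.
Proof.
have tot m : \sum_(0 <= i < m.+1) cayley_coef i = m.*2.+1%:R.
  elim: m => [|m IHm]; first by rewrite big_nat1.
  by rewrite big_nat_recr//= IHm doubleS -[m.*2.+3]addn2 natrD.
elim: n => [|n IHn]; first by rewrite big_nat1 mulr1.
rewrite big_nat_recr//= subnn mulr1.
have -> : \sum_(0 <= i < n.+1) cayley_coef i * (~~ odd (n.+1 - i))%:R =
    n.*2.+1%:R - n.+1%:R.
  rewrite -tot -IHn -sumrB; apply: eq_big_nat => i /andP[_ ile].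
  rewrite subSn//=; case: (odd (n - i)); rewrite /= ?mulr1 ?mulr0 ?subr0//.
  by rewrite subrr.
by rewrite -addnn -addSn natrD [_ - _]addrC addKr -natrD addn2.
Qed.

Lemma deriv_exp_trunc N (p : {poly R}) :
  (exp_trunc N.+1 p)^`() = p^`() * exp_trunc N p.
Proof.
rewrite /exp_trunc linear_sum big_nat_recl//= expr0 derivZ -polyC1 derivC.
rewrite scaler0 add0r mulr_sumr; apply: eq_bigr => k _.
rewrite derivZ deriv_exp/= -scalerAr -[_ *+ k.+1]scaler_nat scalerA.
by rewrite factS natrM invfM mulrAC mulVf ?mul1r// pnatr_eq0.
Qed.

Lemma coef_deriv_cayley_log N i :
  (cayley_log_trunc N)^`()`_i = if (i.+1 < N)%N then (~~ odd i)%:R * 2 else 0.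
Proof.
rewrite coef_deriv coef_poly; case: ifP => _; last by rewrite mul0rn.
by rewrite -[_ *+ i.+1]mulr_natr divfK ?pnatr_eq0.
Qed.

(** With l the truncated logarithm and e_K the truncated exponential of l, one
    has e_(K+1)' = l' e_K, whereas G = (1 + w)/(1 - w) solves G' = L' G for the
    full logarithm L.  Both equations determine the coefficient of index n + 1
    from those of index at most n, and truncation only discards nonnegative
    terms, none of them when n < K <= N. *)
Lemma coef_exp_cayley_log N K n : (K <= N)%N ->
  let e := (exp_trunc K (cayley_log_trunc N))`_n in
  (0 <= e <= cayley_coef n) /\ ((n < K)%N -> e = cayley_coef n).
Proof.
elim: K n => [|K IHK] n KN /=.
  by rewrite /exp_trunc big_geq// coef0 lexx; case: n => /=.
have e0 : (exp_trunc K.+1 (cayley_log_trunc N))`_0 = 1.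
  rewrite -horner_coef0 /exp_trunc horner_sum big_nat_recl//= big1 ?addr0.
    by rewrite expr0 !hornerE fact0 invr1.
  move=> k _; rewrite hornerZ horner_exp horner_coef0 coef_poly.
  by rewrite /cayley_log_coef/= !mul0r if_same expr0n mulr0.
case: n => [|n]; first by rewrite e0 ler01 lexx.
have eS : (exp_trunc K.+1 (cayley_log_trunc N))`_n.+1 = n.+1%:R^-1 *
    \sum_(i < n.+1) (cayley_log_trunc N)^`()`_(n - i)
                    * (exp_trunc K (cayley_log_trunc N))`_i.
  rewrite -coefMr -deriv_exp_trunc coef_deriv -[X in _ * X]mulr_natl mulKf//.
have gS : cayley_coef n.+1 = n.+1%:R^-1 *
    \sum_(i < n.+1) (~~ odd (n - i))%:R * 2 * cayley_coef i.
  have := cayley_coef_convolution n; rewrite big_mkord => sumE.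
  rewrite [X in _ * X](_ : _ = 2 * n.+1%:R); last first.
    by rewrite -sumE mulr_sumr; apply: eq_bigr => i _; ring.
  by rewrite mulrCA mulVf ?mulr1// pnatr_eq0.
have KN' : (K <= N)%N by exact: ltnW.
split=> [|nK]; last first.
  rewrite eS gS; congr (_ * _); apply: eq_bigr => i _.
  rewrite coef_deriv_cayley_log (IHK _ KN').2; last first.
    exact: leq_trans (ltn_ord i) nK.
  by rewrite (leq_trans _ KN)// (leq_trans _ nK)// !ltnS leq_subr.
rewrite eS gS mulr_ge0 ?invr_ge0//=; last first.
  apply: sumr_ge0 => i _; rewrite coef_deriv_cayley_log.
  case: ifP => _; last by rewrite mul0r.
  by rewrite !mulr_ge0//; case/andP: (IHK i KN').1.
rewrite ler_wpM2l ?invr_ge0// ler_sum// => i _.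
have /andP[e_ge0 e_le] := (IHK i KN').1.
rewrite coef_deriv_cayley_log; case: ifP => _.
  by rewrite ler_wpM2l// mulr_ge0.
by rewrite mul0r !mulr_ge0// (le_trans e_ge0 e_le).
Qed.

Context {H : completeNormedModType R[i]} {nz : exists x : H, x != 0}.
Local Notation B := (bop nz).
Implicit Types W : B.

Definition cayley_log W : B := power_series cayley_log_coef W.

Lemma cayley_log_cvg W : `|W| < 1 ->
  series (fun k => cayley_log_coef k *: W ^+ k) @ \oo --> cayley_log W.
Proof.
apply: (@bounded_power_series_cvg _ _ _ 2) => k.
rewrite ger0_norm ?divr_ge0// ?mulr_ge0//.
rewrite /cayley_log_coef; case: k => [|k]; first by rewrite !mul0r.
rewrite ler_pdivrMr ?ltr0n// mulrC ler_wpM2l// ler_nat.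
by case: (odd _).
Qed.

Lemma horner_algZ W (c : R) (p : {poly R}) :
  horner_alg W (c *: p) = c *: horner_alg W p.
Proof. by rewrite -mul_polyC rmorphM/= horner_algC mulr_algl. Qed.

Lemma horner_alg_exp_trunc W N (p : {poly R}) :
  horner_alg W (exp_trunc N p) = exp_trunc N (horner_alg W p).
Proof.
rewrite /exp_trunc rmorph_sum; apply: eq_bigr => k _.
rewrite [LHS]horner_algZ.
by rewrite rmorphXn.
Qed.

(** A polynomial with small coefficients, beginning at a high power, is small
    at an operator of norm less than 1: compare with a geometric series. *)
Lemma horner_alg_le W (p : {poly R}) (M : R) N : 0 <= M -> `|W| < 1 ->
  (forall n, (n < N)%N -> p`_n = 0) -> (forall n, `|p`_n| <= M) ->
  `|horner_alg W p| <= M * `|W| ^+ N / (1 - `|W|).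
Proof.
move=> M0 W1 pN pM.
have -> : horner_alg W p = \sum_(N <= i < N + size p) p`_i *: W ^+ i.
  rewrite -[p in LHS]coefK poly_def rmorph_sum/=.
  transitivity (\sum_(0 <= i < N + size p) p`_i *: W ^+ i).
    rewrite addnC (big_cat_nat (n := size p)) ?leq_addr//=.
    rewrite [X in _ + X]big1_seq ?addr0 => [|i]; last first.
      rewrite mem_index_iota => /andP[_ /andP[si _]].
      by rewrite nth_default// scale0r.
    rewrite big_mkord; apply: eq_bigr => i _.
    by rewrite horner_algZ/= rmorphXn/= horner_algX.
  rewrite (big_cat_nat (n := N)) ?leq_addr//= big1_seq ?add0r// => i.
  by rewrite mem_index_iota => /andP[_ /andP[_ iN]]; rewrite pN// scale0r.
rewrite (le_trans (ler_norm_sum _ _ _))//.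
apply: (@le_trans _ _ (\sum_(N <= i < N + size p) M * `|W| ^+ i)).
  apply: ler_sum => i _; rewrite normrZ ler_pM//.
  exact: bop_normX.
rewrite -mulr_sumr -mulrA ler_wpM2l// geometric_partial_tail.
rewrite geometric_seriesE ?lt_eqF//= -mulrA ler_wpM2l ?exprn_ge0//.
by rewrite -[leRHS]mul1r ler_wpM2r ?gerBl ?exprn_ge0// invr_ge0 subr_ge0 ltW.
Qed.

(** The polynomials p N converge at W to the exponential on the left, and by
    [coef_exp_cayley_log] the polynomial p N (1 - w) - (1 + w) has no term of
    degree less than N and coefficients bounded by 4. *)
Lemma bexp_cayley_log W : `|W| < 1 ->
  bexp (cayley_log W) * (1 - W) = 1 + W.
Proof.
move=> W1; pose p N := exp_trunc N (cayley_log_trunc N).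
have pW : (fun N => horner_alg W (p N)) @ \oo --> bexp (cayley_log W).
  under eq_fun do rewrite horner_alg_exp_trunc.
  apply: exp_trunc_cvg; rewrite [X in X @ \oo --> _](_ : _ =
    series (fun k => cayley_log_coef k *: W ^+ k)); first exact: cayley_log_cvg.
  apply: funext => N.
  rewrite /cayley_log_trunc poly_def rmorph_sum/= /series/= big_mkord.
  by apply: eq_bigr => k _; rewrite horner_algZ/= rmorphXn/= horner_algX.
apply: bop_cvg_unique (bop_cvgM pW (cvg_cst _)) _.
have rmE N : horner_alg W (p N) * (1 - W) - (1 + W) =
    horner_alg W (p N * (1 - 'X) - (1 + 'X)).
  by rewrite rmorphB rmorphM !rmorphD rmorphN !rmorph1/= horner_algX.
apply: (@bop_cvg_transfer _ _ _ _ (cst (1 + W))); last exact: cvg_cst.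
under eq_fun do rewrite rmE.
apply: (@bop_cvg_norm _ _ _ _ _ (fun N => 4 * `|W| ^+ N / (1 - `|W|))).
  move=> N; rewrite subr0; apply: horner_alg_le => // n; last first.
    have /andP[p0 p1] := (coef_exp_cayley_log n (leqnn N)).1.
    have /andP[q0 q1] := (coef_exp_cayley_log n.-1 (leqnn N)).1.
    have c2 i : cayley_coef i <= 2 by case: i => //=; rewrite ler1n.
    rewrite mulrBr mulr1 !coefB coefMX coefD coef1 coefX -/(p N).
    have := le_trans p1 (c2 n); have := le_trans q1 (c2 n.-1).
    rewrite -/(p N) in p0 q0 *.
    move: (_`_n) (_`_n.-1) p0 q0 => a b a0 b0 b2 a2.
    by rewrite ler_norml; case: (n == 0)%N; case: (n == 1)%N => /=; lra.
  move=> nN; have := (coef_exp_cayley_log n (leqnn N)).2 nN.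
  rewrite mulrBr mulr1 !coefB coefMX coefD coef1 coefX -/(p N) => ->.
  case: n nN => [|n] nN /=; first by rewrite subr0 addr0 subrr.
  rewrite (coef_exp_cayley_log n (leqnn N)).2 ?(ltnW nN)// add0r.
  by case: n {nN} => [|n] /=; rewrite ?subr0 ?subrr//; lra.
rewrite -(mul0r (1 - `|W|)^-1); apply: cvgM; last exact: cvg_cst.
rewrite -(mulr0 4); apply: cvgM; first exact: cvg_cst.
by apply: cvg_expr; rewrite normr_id.
Qed.

End CayleyLogarithm.
(** * Inner products *)

Section InnerProduct.
Context {R : realType} {H : hilbertType R}.
Implicit Types (x y z : H) (c : R[i]).

Lemma dotC x y : '[x, y] = ('[y, x])^*.
Proof. by rewrite hermC expr0 mul1r. Qed.

Lemma dotDl x y z : '[x + y, z] = '[x, z] + '[y, z].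
Proof. exact: linearDl. Qed.

Lemma dotDr x y z : '[x, y + z] = '[x, y] + '[x, z].
Proof. exact: linearDr. Qed.

Lemma dotZl c x y : '[c *: x, y] = c * '[x, y].
Proof. exact: linearZl_LR. Qed.

Lemma dotZr c x y : '[x, c *: y] = c^* * '[x, y].
Proof. by rewrite dotC dotZl rmorphM/= -dotC. Qed.

Lemma dotBl x y z : '[x - y, z] = '[x, z] - '[y, z].
Proof. exact: linearBl. Qed.

Lemma dotBr x y z : '[x, y - z] = '[x, y] - '[x, z].
Proof. exact: linearBr. Qed.

Lemma conj_realC (r : R) : (r%:C%C : R[i])^* = r%:C%C.
Proof. by apply: conj_Creal; rewrite complex_real. Qed.

Lemma dot_eq0 x : '[x, x] = 0 -> x = 0.
Proof. by rewrite dotp_norm => /eqP; rewrite expf_eq0/= normr_eq0 => /eqP. Qed.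

Lemma dot_inj x y : (forall z, '[z, x] = '[z, y]) -> x = y.
Proof.
move=> xy; apply/eqP; rewrite -subr_eq0; apply/eqP/dot_eq0.
by rewrite dotBr xy subrr.
Qed.

(** The usual argument: the squared norm of |y|^2 x - (x, y) y is
    |y|^2 (|x|^2 |y|^2 - |(x, y)|^2). *)
Lemma cauchy_schwarz x y : `|'[x, y]| <= `|x| * `|y|.
Proof.
have [->|y0] := eqVneq y 0.
  by rewrite linear0r normr0 mulr_ge0.
have ny : 0 < `|y| ^+ 2 by rewrite exprn_gt0 ?normr_gt0.
rewrite -(@ler_pXn2r _ 2)// ?nnegrE ?mulr_ge0// -(ler_pM2l ny).
rewrite -subr_ge0.
have : 0 <= '[`|y| ^+ 2 *: x - '[x, y] *: y, `|y| ^+ 2 *: x - '[x, y] *: y].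
  by rewrite dotp_norm exprn_ge0.
rewrite !(dotBl, dotBr, dotZl, dotZr) (dotC y x) !dotp_norm normCK exprMn.
rewrite rmorphXn/= (conj_Creal (normr_real y)).
by congr (0 <= _); ring.
Qed.

Definition rdot x y : R := complex.Re '[x, y].

Lemma rnorm_sqr x : rnorm x ^+ 2 = rdot x x.
Proof. by rewrite /rdot dotp_norm rnormE -rmorphXn. Qed.

Lemma rdotC x y : rdot x y = rdot y x.
Proof. by rewrite /rdot dotC; case: '[y, x]. Qed.

Lemma rnormD_sqr x y :
  rnorm (x + y) ^+ 2 = rnorm x ^+ 2 + 2 * rdot x y + rnorm y ^+ 2.
Proof.
rewrite !rnorm_sqr /rdot !(dotDl, dotDr) !raddfD/=.
by rewrite -!/(rdot _ _) (rdotC y); ring.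
Qed.

Lemma rdotNr x y : rdot x (- y) = - rdot x y.
Proof. by rewrite /rdot linearNr raddfN. Qed.

Lemma rnormB_sqr x y :
  rnorm (x - y) ^+ 2 = rnorm x ^+ 2 - 2 * rdot x y + rnorm y ^+ 2.
Proof. by rewrite rnormD_sqr rdotNr rnormN mulrN. Qed.

End InnerProduct.
(** * Relations between operators that pass to power series *)

Section Transfer.
Context {R : realType} {H : completeNormedModType R[i]}.
Context {nz : exists x : H, x != 0}.
Local Notation B := (bop nz).
Implicit Types X Y : B.

(** Two instances are needed: being adjoint to each other, and being conjugate
    under J.  The first one is not the graph of a function that is known
    beforehand to be defined everywhere, and it reverses products, so that only
    powers are considered. *)
Record series_compatible (Q : B -> B -> Prop) : Prop := SeriesCompatible {
  rel_add : forall X X' Y Y', Q X X' -> Q Y Y' -> Q (X + Y) (X' + Y');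
  rel_scale : forall (r : R) X X', Q X X' -> Q (r *: X) (r *: X');
  rel_exp : forall X X' n, Q X X' -> Q (X ^+ n) (X' ^+ n);
  rel_lim : forall (F F' : nat -> B) X X', (forall n, Q (F n) (F' n)) ->
    F @ \oo --> X -> F' @ \oo --> X' -> Q X X'
}.

Lemma rel_power_series Q (c : nat -> R) X X' : series_compatible Q -> Q X X' ->
  series (fun k => c k *: X ^+ k) @ \oo --> power_series c X ->
  series (fun k => c k *: X' ^+ k) @ \oo --> power_series c X' ->
  Q (power_series c X) (power_series c X').
Proof.
move=> [QD QZ QX Qlim] QXX'; apply: Qlim => n.
rewrite /series/=; elim: n => [|n IHn].
  by have := QZ 0 _ _ QXX'; rewrite !scale0r !big_geq.
by rewrite !big_nat_recr//=; apply: QD => //; exact/QZ/QX.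
Qed.

Lemma rel_bexp Q X X' : series_compatible Q -> Q X X' -> Q (bexp X) (bexp X').
Proof.
by move=> cQ QXX'; apply: rel_power_series => //; exact: bexp_cvg.
Qed.

Lemma rel_cayley_log Q W W' : series_compatible Q -> Q W W' ->
  `|W| < 1 -> `|W'| < 1 -> Q (cayley_log W) (cayley_log W').
Proof.
by move=> cQ QWW' W1 W'1; apply: rel_power_series => //; exact: cayley_log_cvg.
Qed.

(** The series has odd terms only. *)
Lemma cayley_logN W : `|W| < 1 -> cayley_log (- W) = - cayley_log W :> B.
Proof.
move=> W1; have NW1 : `|- W| < 1 by rewrite normrN.
apply: bop_cvg_unique (cayley_log_cvg NW1) _.
have -> : series (fun k => cayley_log_coef k *: (- W) ^+ k) =
    - series (fun k => (cayley_log_coef k : R) *: W ^+ k).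
  apply: funext => n; rewrite /series/= -[RHS]sumrN; apply: eq_bigr => k _.
  rewrite exprNn /cayley_log_coef -signr_odd; case: (odd k).
    by rewrite expr1 mulN1r scalerN.
  by rewrite !mul0r !scale0r oppr0.
by apply: cvgN; exact: cayley_log_cvg.
Qed.

Lemma le0_of_cvg0 (u : nat -> R) (M r : R) : u @ \oo --> 0 ->
  (forall n, r <= u n * M) -> r <= 0.
Proof.
move=> u0 ru.
have uM : u n * M @[n --> \oo] --> 0 * M by apply: cvgM u0 _; exact: cvg_cst.
rewrite -(mul0r M) -(cvg_lim (@Rhausdorff R) uM); apply: limr_ge.
  by apply: cvgP uM.
exact: nearW.
Qed.

Lemma bop_cvg_dist (F : nat -> B) X :
  F @ \oo --> X -> `|X - F n| @[n --> \oo] --> (0 : R).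
Proof.
move=> FX; apply/norm_cvg0P; rewrite -(subrr X).
by apply: cvgB FX; exact: cvg_cst.
Qed.

End Transfer.

(** * Adjoint operators *)

Section HilbertOperators.
Context {R : realType} {H : hilbertType R} {nz : exists x : H, x != 0}.
Local Notation B := (bop nz).
Implicit Types X Y W P : B.

Definition adj X Y := forall x y, '[X x, y] = '[x, Y y].

Lemma adj_sym X Y : adj X Y -> adj Y X.
Proof. by move=> XY x y; rewrite dotC -XY -dotC. Qed.

Lemma adjM X X' Y Y' : adj X X' -> adj Y Y' -> adj (X * Y) (Y' * X').
Proof. by move=> XX' YY' x y; rewrite !bopE XX' YY'. Qed.

Lemma adjD X X' Y Y' : adj X X' -> adj Y Y' -> adj (X + Y) (X' + Y').
Proof. by move=> XX' YY' x y; rewrite !bopE dotDl dotDr XX' YY'. Qed.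

Lemma adjZ (r : R) X X' : adj X X' -> adj (r *: X) (r *: X').
Proof. by move=> XX' x y; rewrite !bopE dotZl dotZr XX' conj_realC. Qed.

Lemma adj1 : adj 1 1. Proof. by []. Qed.

Lemma adjX X X' n : adj X X' -> adj (X ^+ n) (X' ^+ n).
Proof.
move=> XX'; elim: n => [|n IHn]; first exact: adj1.
by rewrite exprS exprSr; exact: adjM.
Qed.

Lemma adj_lim (F F' : nat -> B) X X' : (forall n, adj (F n) (F' n)) ->
  F @ \oo --> X -> F' @ \oo --> X' -> adj X X'.
Proof.
move=> FF' FX FX' x y; apply/eqP; rewrite -subr_eq0 -normr_eq0.
set z := '[X x, y] - '[x, X' y].
have zE n : z = '[(X - F n) x, y] - '[x, (X' - F' n) y].
  by rewrite !bopE dotBl dotBr FF' opprB addrA subrK.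
rewrite eq_le normr_ge0 andbT -[`|z|]RRe_real ?normr_real// (lecR _ 0).
have u0 : `|X - F n| + `|X' - F' n| @[n --> \oo] --> (0 : R).
  by rewrite -[0 in X in _ --> X](addr0 0); apply: cvgD; exact: bop_cvg_dist.
apply: (@le0_of_cvg0 _ _ (rnorm x * rnorm y) _ u0) => n.
rewrite -lecR RRe_real ?normr_real// (zE n) (le_trans (ler_normB _ _))//.
rewrite mulrDl rmorphD lerD// (le_trans (cauchy_schwarz _ _))// !rnormE.
  rewrite -rmorphM lecR mulrA ler_wpM2r ?rnorm_ge0//.
  exact: le_bop_norm.
rewrite -rmorphM lecR mulrCA ler_wpM2l ?rnorm_ge0//.
exact: le_bop_norm.
Qed.

Lemma adj_series_compatible : series_compatible adj.
Proof.
split; [exact: adjD | exact: adjZ | | exact: adj_lim].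
by move=> X X' n; exact: adjX.
Qed.

End HilbertOperators.
(** * Conjugations *)

Section Conjugation.
Context {R : realType} {H : hilbertType R}.
Context (J : H -> H) (hJ : conjugation J).
Implicit Types x y : H.

Lemma conjugationK x : J (J x) = x.
Proof. exact: (congr1 (fun f : H -> H => f x) hJ.1). Qed.

Lemma conjugation_dot x y : '[J x, y] = '[J y, x].
Proof. by rewrite -[y in LHS]conjugationK hJ.2 -dotC. Qed.

(** Additivity and antilinearity are forced: the values of J are determined by
    their inner products against the whole space. *)
Lemma conjugationD x y : J (x + y) = J x + J y.
Proof.
apply: dot_inj => z; rewrite dotDr !(dotC z) !(conjugation_dot _ z) dotDr.
by rewrite rmorphD.
Qed.

Lemma conjugationZ (c : R[i]) x : J (c *: x) = c^* *: J x.
Proof.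
apply: dot_inj => z; rewrite dotZr !(dotC z) !(conjugation_dot _ z) dotZr.
by rewrite rmorphM.
Qed.

Lemma conjugationN x : J (- x) = - J x.
Proof. by rewrite -scaleN1r conjugationZ rmorphN rmorph1 scaleN1r. Qed.

Lemma conjugationB x y : J (x - y) = J x - J y.
Proof. by rewrite conjugationD conjugationN. Qed.

Lemma rnorm_conjugation x : rnorm (J x) = rnorm x.
Proof.
apply/eqP; rewrite -(@eqrXn2 _ 2) ?rnorm_ge0// !rnorm_sqr /rdot hJ.2.
by case: '[x, x].
Qed.

Context {nz : exists x : H, x != 0}.
Local Notation B := (bop nz).
Implicit Types X Y : B.

Definition conjugate_ops X Y := forall x, J (X x) = Y (J x).

Lemma conjugate_ops_lim (F F' : nat -> B) X X' :
  (forall n, conjugate_ops (F n) (F' n)) ->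
  F @ \oo --> X -> F' @ \oo --> X' -> conjugate_ops X X'.
Proof.
move=> FF' FX FX' x; apply/eqP; rewrite -subr_eq0 -rnorm_eq0.
have zE n : J (X x) - X' (J x) = J ((X - F n) x) - (X' - F' n) (J x).
  by rewrite !bopE conjugationB FF' opprB addrA subrK.
rewrite eq_le rnorm_ge0 andbT.
have u0 : `|X - F n| + `|X' - F' n| @[n --> \oo] --> (0 : R).
  by rewrite -[0 in X in _ --> X](addr0 0); apply: cvgD; exact: bop_cvg_dist.
apply: (@le0_of_cvg0 _ _ (rnorm x) _ u0) => n.
rewrite (zE n) (le_trans (rnormB _ _))// mulrDl rnorm_conjugation lerD//.
  exact: le_bop_norm.
by rewrite -[in leRHS]rnorm_conjugation le_bop_norm.
Qed.

Lemma conjugate_ops_series_compatible : series_compatible conjugate_ops.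
Proof.
split=> [X X' Y Y' XX' YY' x|r X X' XX' x|X X' n XX' x|].
- by rewrite !bopE conjugationD XX' YY'.
- by rewrite !bopE conjugationZ XX' conj_realC.
- by rewrite !bopEX; elim: n => //= n <-; rewrite XX'.
- exact: conjugate_ops_lim.
Qed.

End Conjugation.

(** * The Cayley transform of the Gram operator *)

Section PolarDecomposition.
Context {R : realType} {H : hilbertType R} {nz : exists x : H, x != 0}.
Local Notation B := (bop nz).
Implicit Types A P V W : B.

Lemma rdot_gram A A' : adj A A' ->
  forall x, rdot (A' (A x)) x = rnorm (A x) ^+ 2.
Proof. by move=> AA' x; rewrite rnorm_sqr /rdot (adj_sym AA'). Qed.

(** Put P = A' A and M = |A'|^2.  Then |P x|^2 <= M |A x|^2 = M (P x, x), so the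
    cross term in |M x - P x|^2 = M^2 |x|^2 - 2 M (P x, x) + |P x|^2 dominates
    the last term. *)
Lemma norm_shift_le A A' : adj A A' ->
  `|(`|A'| ^+ 2)%:A - A' * A| <= `|A'| ^+ 2.
Proof.
move=> AA'; set M := _ ^+ 2; have M0 : 0 <= M by rewrite exprn_ge0.
apply: bop_norm_le => // x.
rewrite -(@ler_pXn2r _ 2) ?nnegrE ?mulr_ge0 ?rnorm_ge0//.
rewrite !bopE rnormB_sqr rnormZR exprMn (ger0_norm M0) [leRHS]exprMn.
have -> : rdot (M%:C%C *: x) (A' (A x)) = M * rnorm (A x) ^+ 2.
  rewrite -(rdot_gram AA') [in RHS]rdotC /rdot dotZl.
  by case: '[x, _] => a b /=; ring.
have : rnorm (A' (A x)) ^+ 2 <= M * rnorm (A x) ^+ 2.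
  rewrite -exprMn ler_pXn2r ?nnegrE ?mulr_ge0 ?rnorm_ge0//.
  exact: le_bop_norm.
have : 0 <= M * rnorm (A x) ^+ 2 by rewrite mulr_ge0// exprn_ge0// rnorm_ge0.
move=> q0 pq; rewrite -addrA gerDl.
lra.
Qed.

(** Write 1 + P = (1 + M)(1 - T) with (1 + M) T = M - P; by [norm_shift_le] the
    norm of T is at most M/(1 + M), so that 1 - T has a Neumann inverse. *)
Lemma one_plus_gram_invertible A A' : adj A A' ->
  exists V, V * (1 + A' * A) = 1 /\ (1 + A' * A) * V = 1.
Proof.
move=> AA'; set P := A' * A; set M := `|A'| ^+ 2.
have M0 : 0 <= M by rewrite exprn_ge0.
have M1 : 0 < 1 + M by rewrite ltr_pwDl.
have M1neq0 : 1 + M != 0 by rewrite gt_eqF.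
pose T : B := (1 + M)^-1 *: (M%:A - P).
have T1 : `|T| < 1.
  rewrite normrZ ger0_norm ?invr_ge0 ?(ltW M1)// mulrC ltr_pdivrMr// mul1r.
  by rewrite (le_lt_trans (norm_shift_le AA'))// ltrDr.
have TP : 1 - T = (1 + M)^-1 *: (1 + P).
  rewrite -[1 in LHS](scalerK M1neq0) /T -scalerBr; congr (_ *: _).
  by rewrite scalerDl scale1r opprB [P - _]addrC addrA addrK.
have [V [VT TV]] := neumann_inverse T1.
exists ((1 + M)^-1 *: V); rewrite -scalerAl scalerAr -TP VT; split=> //.
by rewrite -scalerAr scalerAl -TP TV.
Qed.

(** For x = (1 + P) y one finds |W x|^2 = |P y - y|^2 = |x|^2 - 4 |A y|^2, and
    |A y| is at least a fixed multiple of |x| because A has the bounded left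
    inverse C. *)
Lemma cayley_transform_lt1 A A' C V : adj A A' -> C * A = 1 ->
  (1 + A' * A) * V = 1 -> `|(A' * A - 1) * V| < 1.
Proof.
move=> AA' CA PV; set P := A' * A in PV *.
(* |x| <= k |A y|, and 1 - 4 d <= (1 - d)^2 *)
set k := (`|C| + 1) * (1 + `|P|); set d := k ^- 2.
have k1 : 1 <= k.
  by rewrite /k -[leLHS]mulr1 ler_pM// ?lerDl ?lerDr.
have k0 : 0 < k by exact: lt_le_trans k1.
have d0 : 0 < d by rewrite invr_gt0 exprn_gt0.
have d1 : d <= 1 by rewrite invf_le1 ?exprn_gt0// exprn_ege1.
suff : `|(P - 1) * V| <= 1 - d by move=> /le_lt_trans; apply; rewrite gtrBl.
apply: bop_norm_le => [|x]; first by rewrite subr_ge0.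
rewrite -(@ler_pXn2r _ 2) ?nnegrE ?mulr_ge0 ?rnorm_ge0 ?subr_ge0//.
have xE : x = V x + P (V x) := esym (congr1 (fun Z : B => Z x) PV).
rewrite exprMn bopEM bopEB bopE1; move: (V x) xE => y ->.
have q : rdot (P y) y = rnorm (A y) ^+ 2 by exact: rdot_gram.
have ky : rnorm (y + P y) <= k * rnorm (A y).
  apply: (@le_trans _ _ ((1 + `|P|) * rnorm y)).
    rewrite (le_trans (rnormD _ _))// mulrDl mul1r lerD2l.
    exact: le_bop_norm.
  rewrite /k [_ * (1 + _)]mulrC -mulrA ler_wpM2l ?addr_ge0//.
  rewrite -[in leLHS](bopE1 (nz := nz) y) -CA bopEM.
  by rewrite (le_trans (le_bop_norm C _))// ler_wpM2r ?rnorm_ge0// lerDl ler01.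
rewrite rnormB_sqr q.
have kd : rnorm (y + P y) ^+ 2 * d <= rnorm (A y) ^+ 2.
  rewrite ler_pdivrMr ?exprn_gt0// mulrC -exprMn.
  by rewrite ler_pXn2r ?nnegrE ?mulr_ge0 ?rnorm_ge0// ltW.
have -> : rnorm (P y) ^+ 2 - 2 * rnorm (A y) ^+ 2 + rnorm y ^+ 2 =
    rnorm (y + P y) ^+ 2 - 4 * rnorm (A y) ^+ 2.
  by rewrite rnormD_sqr rdotC q; ring.
have : 0 <= rnorm (y + P y) ^+ 2 by rewrite exprn_ge0// rnorm_ge0.
move: (rnorm (y + P y) ^+ 2) (rnorm (A y) ^+ 2) kd => a b ab a0.
have : 0 <= a * d by rewrite mulr_ge0// ltW.
have : 0 <= d ^+ 2 * a by rewrite mulr_ge0// exprn_ge0// ltW.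
move: d ab {d0 d1} => e; nra.
Qed.

End PolarDecomposition.
(** * Polar decomposition of J-unitary operators *)

Section JUnitary.
Context {R : realType} {H : hilbertType R} {nz : exists x : H, x != 0}.
Local Notation B := (bop nz).

Lemma adj_inverse (X X' Y : B) : adj X X' -> Y * X = 1 -> X * Y = 1 ->
  forall Y', X' * Y' = 1 -> adj Y Y'.
Proof.
move=> XX' YX XY Y' X'Y' x y.
rewrite -[in LHS](bopE1 (nz := nz) y) -X'Y' bopEM -XX' -bopEM XY.
by rewrite bopE1.
Qed.

(** U = A exp(-S) with adjoint exp(-S) A'.  For J-reality, the relation between
    C and A' gives J A J A' = 1; as A' A exp(-S) = exp(S), the vector
    J U J x = J A J exp(S) x equals U x. *)
Lemma polar_of_logarithm (J : H -> H) (A C A' S : B) : conjugation J ->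
  C * A = 1 -> A * C = 1 -> adj A A' -> (forall x, C x = J (A' (J x))) ->
  adj S S -> conjugate_ops J S (- S) -> bexp S * bexp S = A' * A ->
  exists U U' : B, [/\ adj U U', U' * U = 1, U * U' = 1,
    conjugate_ops J U U & A = U * bexp S].
Proof.
move=> hJ CA AC AA' CJ SS JS eSS; set E := bexp S; set F := bexp (- S).
have FE : F * E = 1 := bexpNK S.
have EF : E * F = 1 := bexpKN S.
have FF : adj F F.
  apply: (rel_bexp adj_series_compatible).
  by rewrite -scaleN1r; exact: adjZ.
have UU : (F * A') * (A * F) = 1.
  by rewrite mulrA -[F * A' * A]mulrA -eSS -/E mulrA FE mul1r EF.
have UV : (A * F) * (E * C) = 1 by rewrite mulrA -[A * F * E]mulrA FE mulr1.
exists (A * F), (F * A'); split => //.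
- exact: adjM.
- by rewrite -[F * A']mulr1 -UV [F * A' * _]mulrA UU mul1r.
- move=> x; rewrite !bopEM.
  have JF y : J (F y) = E (J y).
    suff : conjugate_ops J F E by apply.
    apply: (rel_bexp (conjugate_ops_series_compatible hJ)) => z.
    by rewrite bopEN conjugationN// JS bopEN opprK.
  (* A' A F = E, so it is enough to know J A J on the range of A' *)
  have JA v : J (A (J (A' v))) = v.
    by rewrite -[v](conjugationK hJ) -CJ -bopEM AC.
  have AF : A' (A (F (J x))) = E (J x).
    by rewrite -[LHS]/((A' * A * F) (J x)) -eSS -mulrA EF mulr1.
  by rewrite -[F x](conjugationK hJ) JF -AF JA.
- by rewrite -mulrA FE mulr1.
Qed.

(** S is half the logarithm of the Cayley transform W of P = A' A.  The identity
    P J P = J turns into J W = -W J, and the oddness of the logarithm carries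
    this over to S. *)
Lemma gram_logarithm (J : H -> H) (A C A' : B) : conjugation J ->
  C * A = 1 -> A * C = 1 -> adj A A' -> (forall x, C x = J (A' (J x))) ->
  exists S : B, [/\ adj S S, conjugate_ops J S (- S) &
    bexp S * bexp S = A' * A].
Proof.
move=> hJ CA AC AA' CJ; set P := A' * A.
have PP : adj P P by apply: adjM => //; exact: adj_sym.
have [V [VP PV]] := one_plus_gram_invertible AA'; rewrite -/P in VP PV.
have comPV : P * V = V * P.
  by apply: (addrI V); rewrite -{1}[V]mul1r -mulrDl PV -VP mulrDr mulr1.
set W := (P - 1) * V.
have W1 : `|W| < 1 by exact: cayley_transform_lt1 AA' CA PV.
have NW1 : `|- W| < 1 by rewrite normrN.
have VV : adj V V.
  by apply: (adj_inverse _ VP PV PV); apply: adjD => //; exact: adj1.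
have WW : adj W W.
  have -> : W = V * (P - 1) by rewrite /W mulrBl mulrBr comPV mul1r mulr1.
  rewrite [X in adj _ X](_ : _ = (P - 1) * V); last first.
    by rewrite mulrBl mulrBr comPV mul1r mulr1.
  apply: adjM => //; apply: adjD => //.
  by rewrite -scaleN1r; apply: adjZ; exact: adj1.
have JPJP x : P (J (P x)) = J x.
  have AJA' y : A (J (A' y)) = J y.
    by rewrite -[y in A' y](conjugationK hJ) -CJ -bopEM AC.
  have A'JA y : A' (J (A y)) = J y.
    by rewrite -[LHS](conjugationK hJ) -CJ -bopEM CA.
  by rewrite /P !bopEM AJA' A'JA.
have JW : conjugate_ops J W (- W).
  move=> x; have -> : x = V x + P (V x) := esym (congr1 (fun Z : B => Z x) PV).
  move: (V x) => y.
  have -> : y + P y = (1 + P) y by [].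
  rewrite -bopEM /W -mulrA VP mulr1.
  have -> : J ((1 + P) y) = (1 + P) (J (P y)).
    by rewrite !bopED !bopE1 JPJP (conjugationD hJ) addrC.
  rewrite -bopEM mulNr -mulrA VP mulr1 opprB.
  by rewrite !bopEB !bopE1 JPJP (conjugationB hJ).
pose S : B := 2^-1 *: cayley_log W.
have logW : adj (cayley_log W) (cayley_log W).
  exact: (rel_cayley_log adj_series_compatible).
have JlogW : conjugate_ops J (cayley_log W) (- cayley_log W).
  rewrite -cayley_logN//.
  exact: rel_cayley_log (conjugate_ops_series_compatible hJ) JW W1 NW1.
exists S; split; first exact: adjZ.
  rewrite /S -scalerN.
  exact: (rel_scale (conjugate_ops_series_compatible hJ)).
have half (X : B) : 2^-1 *: X + 2^-1 *: X = X.
  by rewrite -scalerDl (_ : _ + _ = 1) ?scale1r//; lra.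
rewrite -bexpD// half; have := bexp_cayley_log W1.
move/(congr1 (fun Z : B => Z * (1 + P))); rewrite -mulrA.
have WP : W * (1 + P) = P - 1 by rewrite -mulrA VP mulr1.
have -> : (1 - W) * (1 + P) = 1 + 1.
  by rewrite mulrBl mul1r WP opprB addrACA subrr addr0.
have -> : (1 + W) * (1 + P) = P + P.
  by rewrite mulrDl mul1r WP [P - 1]addrC addrACA subrr add0r.
rewrite mulrDr mulr1 => eLP.
by rewrite -[LHS]half -scalerDr eLP scalerDr half.
Qed.

End JUnitary.
(** * Operators given as functions *)

Section Dictionary.
Context {R : realType} {H : hilbertType R}.
Implicit Types (T : H -> H) (J : H -> H).

Lemma adjointP T T' : (forall x y, '[T x, y] = '[x, T' y]) -> adjoint T = T'.
Proof.
move=> TT'; apply: funext => y; apply: dot_inj => x; rewrite -TT'.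
rewrite /adjoint; case: xgetP => [S _ TS|/(_ T')/(_ TT')//].
by rewrite -TS.
Qed.

(** J-unitarity itself forces the adjoint to exist: otherwise the default value
    0 would make the inverse of T constant, which leaves only the zero space. *)
Lemma J_unitary_adjoint J T : conjugation J -> J_unitary J T ->
  forall x y, '[T x, y] = '[x, adjoint T y].
Proof.
move=> hJ [_ [T' [_ TK _ T'E]]]; rewrite /adjoint in T'E *.
case: xgetP T'E => [S _ TS _ x y|noadj T'E]; first exact: TS.
have cst0 (x : H) : x = 0.
  have T'x y : T' y = J 0 by rewrite T'E /=.
  by rewrite -(TK x) -(TK 0) !T'x.
by case: (noadj id) => x y; rewrite (cst0 x) (cst0 (T 0)) !linear0l.
Qed.

Lemma operator_cvg_unique (F : nat -> H -> H) E E' :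
  operator_cvg F E -> operator_cvg F E' -> E = E'.
Proof.
move=> FE FE'; apply: funext => x; apply/eqP.
rewrite -subr_eq0 -rnorm_eq0 eq_le rnorm_ge0 andbT.
apply/ler_addgt0Pr => d d0; rewrite add0r.
pose k := rnorm x + 1; have k0 : 0 < k by rewrite ltr_wpDl ?rnorm_ge0.
pose e := d / 2 / k; have e0 : 0 < e by rewrite !divr_gt0.
have eC : 0 < e%:C%C :> R[i] by rewrite ltcR.
have [n [/(_ x) En /(_ x) E'n]] := filter_ex (filterI (FE _ eC) (FE' _ eC)).
rewrite !rnormE -rmorphM lecR in En; rewrite !rnormE -rmorphM lecR in E'n.
have ek : e * rnorm x <= d / 2.
  by rewrite /e -mulrA ger_pMr ?divr_gt0// mulrC ler_pdivrMr// mul1r lerDl.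
have -> : E x - E' x = (F n x - E' x) - (F n x - E x).
  by rewrite opprB [RHS]addrC addrA subrK.
rewrite (le_trans (rnormB _ _))// [leRHS](splitr d) lerD//.
  exact: le_trans E'n ek.
exact: le_trans En ek.
Qed.

Context {nz : exists x : H, x != 0}.
Local Notation B := (bop nz).
Implicit Types X Y : B.

Lemma bop_bounded_operator X : bounded_operator X.
Proof.
split; first exact: bop_linear.
have [M XM] := bop_bounded X; exists M%:C%C => x.
by rewrite !rnormE -rmorphM lecR.
Qed.

Lemma bop_of_bounded T : bounded_operator T -> exists X : B, X = T :> (H -> H).
Proof.
move=> [Tlin [M TM]].
suff TM' : exists M : R, forall x, rnorm (T x) <= M * rnorm x.
  by exists (Bop nz Tlin TM').
exists (complex.Re M) => x; have := TM x; rewrite !rnormE lecE => /andP[_].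
by case: M {TM} => a b /=; rewrite mulr0 subr0.
Qed.

Lemma operator_expE X : operator_exp X = bexp X.
Proof.
have expX : operator_cvg (series (fun k => (k`!%:R)^-1 *: iter k X)) (bexp X).
  move=> e e0; have re0 : 0 < complex.Re e by rewrite -ltcR RRe_real ?gtr0_real.
  have /cvgrPdist_le/(_ _ re0) := @bexp_cvg _ _ _ X; apply: filterS => n eXn x.
  have -> : series (fun k => (k`!%:R)^-1 *: iter k X) n x = exp_trunc n X x.
    rewrite /series/= /exp_trunc bop_sumE; elim: {eXn}n => [|n IHn].
      by rewrite !big_geq.
    by rewrite !big_nat_recr//= -IHn bopEX rmorphV ?unitfE// rmorph_nat.
  have -> : exp_trunc n X x - bexp X x = (exp_trunc n X - bexp X) x by [].
  rewrite rnormE -[e]RRe_real ?gtr0_real// rnormE -rmorphM lecR.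
  rewrite (le_trans (le_bop_norm _ _))// ler_wpM2r ?rnorm_ge0//.
  by rewrite distrC.
rewrite /operator_exp; case: xgetP => [E _ expE|/(_ (bexp X))/(_ expX)//].
exact: operator_cvg_unique expE expX.
Qed.

End Dictionary.
(** * The representation of J-unitary operators *)

Theorem theorem2p1 (R : realType) (H : hilbertType R)
    (hsep : separable_space H)
    (J : H -> H) (hJ : conjugation J)
    (A : H -> H) (hA : J_unitary J A) :
  exists U K : H -> H,
    [/\ unitary U /\ J_real J U,
        bounded_operator K, J_real J K, skew_self_adjoint K &
        A = U \o operator_exp ('i *: K)].
Proof.
(* on the zero space all functions agree *)
have [nz|H0] := pselect (exists x : H, x != 0); last first.
  have all0 (x : H) : x = 0.
    by apply: contrapT => /eqP x0; apply: H0; exists x.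
  have allE (f g : H -> H) : f = g.
    by apply: funext => x; rewrite (all0 (f x)) (all0 (g x)).
  have bd (f : H -> H) : bounded_operator f.
    by rewrite (allE f id); split=> //; exists 1 => x; rewrite mul1r.
  exists id, id; split; [split; first split | | | |] => //; try exact: allE.
  - by move=> x; rewrite [LHS]all0 [RHS]all0.
  - by move=> x; rewrite [LHS]all0 [RHS]all0.
have adjA := J_unitary_adjoint hJ hA.
case: hA => bA [T' [bT' AK KA T'E]].
have [a aE] := bop_of_bounded (nz := nz) bA.
have [c cE] := bop_of_bounded (nz := nz) bT'.
have bA' : bounded_operator (adjoint A).
  have A'E x : adjoint A x = J (T' (J x)) by rewrite T'E /= !(conjugationK hJ).
  split=> [k x y|].
    rewrite !A'E (conjugationD hJ) (conjugationZ hJ) -cE bop_linear.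
    by rewrite (conjugationD hJ) (conjugationZ hJ) conjCK.
  exists (`|c|%:C%C) => x; rewrite A'E -cE !rnormE -rmorphM lecR.
  rewrite (rnorm_conjugation hJ) -[in leRHS](rnorm_conjugation hJ).
  exact: le_bop_norm.
have [a' a'E] := bop_of_bounded (nz := nz) bA'.
have ca : c * a = 1 by apply: bopP => x; rewrite bopEM cE aE AK.
have ac : a * c = 1 by apply: bopP => x; rewrite bopEM cE aE KA.
have aa' : adj a a' by move=> x y; rewrite aE a'E.
have cJ x : c x = J (a' (J x)) by rewrite cE a'E T'E.
have [S [SS JS eS]] := gram_logarithm hJ ca ac aa' cJ.
have [U [U' [UU' U'U UU JU aU]]] := polar_of_logarithm hJ ca ac aa' cJ SS JS eS.
have adjU : adjoint U = U' by exact: adjointP.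
exists U, (fun x => - 'i *: S x); split.
- split; first split.
  + exact: bop_bounded_operator.
  + by move=> x; rewrite adjU -bopEM U'U.
  + by move=> x; rewrite adjU -bopEM UU.
  + by apply: funext => x /=; rewrite JU (conjugationK hJ).
- split=> [k x y|].
    by rewrite /= bop_linear scalerDr !scalerA [k * _]mulrC.
  exists (`|S|%:C%C) => x; rewrite normrZ normrN normCi mul1r !rnormE -rmorphM.
  by rewrite lecR le_bop_norm.
- apply: funext => x /=; rewrite (conjugationZ hJ) JS (conjugationK hJ) bopEN.
  by rewrite rmorphN/= conjCi opprK scalerN scaleNr.
- apply: adjointP => x y; rewrite -[in RHS]/(- (- 'i *: S y)).
  by rewrite dotZl SS -scaleNr opprK dotZr conjCi.
- have -> : 'i *: (fun x => - 'i *: S x) = S.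
    apply: funext => x; rewrite -[LHS]/('i *: (- 'i *: S x)).
    by rewrite scalerA mulrN -expr2 sqrCi opprK scale1r.
  by rewrite operator_expE -aE aU.
Qed.
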